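(* Let $\mathcal{H}$ be a complex Hilbert space and let $T\in\mathcal{B}(\mathcal{H}\oplus\mathcal{H})$ have Cartesian decomposition $$T=\begin{bmatrix} A_{11} & A_{12}\\ A_{12}^* & A_{22}\end{bmatrix}+\mathrm{i}\begin{bmatrix} B_{11} & B_{12}\\ B_{12}^* & B_{22}\end{bmatrix},$$ where all blocks belong to $\mathcal{B}(\mathcal{H})$. Then $$\max(\alpha,\beta)\le\omega(T),$$ where $$\alpha=\max\left(\|A_{11}\|,\|A_{22}\|,\frac{\|A_{12}+A_{12}^*\|}{2},\frac{\|A_{12}-A_{12}^*\|}{2}\right)$$ and $$\beta=\max\left(\|B_{11}\|,\|B_{22}\|,\frac{\|B_{12}+B_{12}^*\|}{2},\frac{\|B_{12}-B_{12}^*\|}{2}\right).$$ Further, the inequality is sharp, i.e., there exist a complex Hilbert space $\mathcal{H}$ and a $T\in\mathcal{B}(\mathcal{H}\oplus\mathcal{H})$ for which equality holds with both sides nonzero.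
   Context: $\mathcal{B}(\mathcal{K})$ denotes the algebra of bounded linear operators on a complex Hilbert space $\mathcal{K}$, and $\|\cdot\|$ is the operator norm. The numerical radius of $S\in\mathcal{B}(\mathcal{K})$ is $\omega(S)=\sup_{\|x\|=1}|\langle Sx,x\rangle|$. The real and imaginary parts of $S$ are $\mathcal{R}S=\frac{S+S^*}{2}$ and $\mathcal{I}S=\frac{S-S^*}{2\mathrm{i}}$, both self-adjoint, and the Cartesian decomposition of $S$ is $S=\mathcal{R}S+\mathrm{i}\,\mathcal{I}S$; thus in the claim $\begin{bmatrix} A_{11} & A_{12}\\ A_{12}^* & A_{22}\end{bmatrix}=\mathcal{R}T$ and $\begin{bmatrix} B_{11} & B_{12}\\ B_{12}^* & B_{22}\end{bmatrix}=\mathcal{I}T$. *)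

(* Defs.v *)
(* The complex field over R : realType is R[i]; the norm of a normed
   R[i]-module takes nonnegative values in R[i], and complex.Re turns it into
   an element of R. *)
From HB Require Import structures.
From mathcomp Require Import all_boot all_order all_algebra.
From mathcomp Require Import complex ring lra.
From mathcomp Require Import boolp classical_sets functions reals.
From mathcomp Require Import topology normedtype.

Set Implicit Arguments.
Unset Strict Implicit.
Unset Printing Implicit Defensive.

Import Order.TTheory GRing.Theory Num.Theory Num.Def.
Import numFieldNormedType.Exports.

Local Open Scope classical_set_scope.
Local Open Scope ring_scope.

Section DotTheory.
Variables (C : numClosedFieldType) (U : lmodType C).
Variable form : {dot U for conjC}.
Local Notation "''[' u , v ]" := (form u%R v%R) : ring_scope.
Local Notation "''[' u ]" := '[u, u]%R : ring_scope.

Lemma dot_CauchySchwarz (u v : U) : `|'[u, v]| <= sqrtC '[u] * sqrtC '[v].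
Proof.
rewrite -(sqrCK (normr_ge0 _)) -sqrtCM ?nnegrE ?dnorm_ge0//.
rewrite ler_sqrtC ?nnegrE ?exprn_ge0 ?mulr_ge0 ?dnorm_ge0//.
have [-> | nz_v] := eqVneq v 0.
  by rewrite !linear0r normr0 expr0n mulr0.
pose a := '[u, v] / '[v]; pose w := u - a *: v.
have ow : '[w, v] = 0.
  by rewrite linearBl /= linearZl_LR /= divfK ?dnorm_eq0// subrr.
have -> : u = w + a *: v by rewrite subrK.
have owv : '[w, a *: v] = 0 by rewrite linearZr_LR /= ow mulr0.
rewrite linearDl /= ow add0r linearZl_LR /= hnormDd//.
rewrite linearZl_LR linearZr_LR /= mulrA -normCK.
rewrite normrM (ger0_norm (dnorm_ge0 _ v)) exprMn mulrDl.
rewrite [leLHS](_ : _ = `|a| ^+ 2 * '[v] * '[v]); last by rewrite -mulrA.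
by rewrite lerDr mulr_ge0 ?dnorm_ge0.
Qed.

Lemma dot_triangle u v : sqrtC '[u + v] <= sqrtC '[u] + sqrtC '[v].
Proof.
rewrite -ler_sqr ?rpredD ?nnegrE ?sqrtC_ge0 ?addr_ge0 ?sqrtC_ge0 ?dnorm_ge0//.
rewrite sqrrD !sqrtCK dnormD [leRHS]addrAC lerD2l/=.
apply: (@le_trans _ _ (2 * `|'[u, v]|)).
  have -> : '[u, v] + '[u, v]^* = 2 * 'Re '[u, v].
    by rewrite ReE mulrC divfK// pnatr_eq0.
  by rewrite ler_pM2l ?ltr0n//; exact: leif_Re_Creal.
by rewrite -[leRHS]mulr_natl ler_pM2l ?ltr0n// dot_CauchySchwarz.
Qed.

End DotTheory.

(* inner is linear in its first argument, conjugate-linear in the second. *)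
HB.mixin Record NormedModule_isHilbert (R : realType) V
    of CompleteNormedModule R[i] V := {
  inner : {dot V for conjC};
  sqr_norm_inner : forall x : V, `|x| ^+ 2 = inner x x
}.

#[short(type="hilbertType")]
HB.structure Definition Hilbert (R : realType) :=
  {V of CompleteNormedModule R[i] V & NormedModule_isHilbert R V}.

Section HilbertTheory.
Variables (R : realType) (H : hilbertType R).
Implicit Types x y : H.

Lemma norm_inner x : `|x| = sqrtC (inner x x).
Proof. by rewrite -sqr_norm_inner sqrCK. Qed.

Lemma inner_CauchySchwarz x y : `|inner x y| <= `|x| * `|y|.
Proof. by rewrite !norm_inner dot_CauchySchwarz. Qed.

Lemma inner_ext x y : (forall z, inner z x = inner z y) -> x = y.
Proof.
move=> xy; apply/eqP; rewrite -subr_eq0 -(dnorm_eq0 (@inner R H)).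
by rewrite linearBr /= xy subrr.
Qed.

End HilbertTheory.

(* H1 (+) H2, on an alias of H1 * H2: the library already equips H1 * H2 with
   the sup norm, which does not come from an inner product. *)
Definition hsum (R : realType) (H1 H2 : hilbertType R) : Type :=
  (H1 * H2)%type.

Section HilbertSum.
Variables (R : realType) (H1 H2 : hilbertType R).
Local Notation V := (hsum H1 H2).

HB.instance Definition _ := GRing.Lmodule.copy V (H1 * H2)%type.

Definition hsum_inner (x y : V) : R[i] := inner x.1 y.1 + inner x.2 y.2.

Let hsum_bilinear : bilinear_for *%R (conjC \; *%R) hsum_inner.
Proof.
split=> u a x y /=; rewrite /hsum_inner /=.
  by rewrite !linearPl /= mulrDr addrACA.
by rewrite !linearPr /= mulrDr addrACA.
Qed.

HB.instance Definition _ :=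
  bilinear_isBilinear.Build R[i] V V R[i] *%R (conjC \; *%R)
    hsum_inner hsum_bilinear.

Let hsum_hermitian x y :
  hsum_inner x y = (-1) ^+ false * conjC (hsum_inner y x).
Proof.
by rewrite /hsum_inner expr0 mul1r rmorphD /=; congr (_ + _);
  rewrite hermC expr0 mul1r.
Qed.

HB.instance Definition _ :=
  isHermitianSesquilinear.Build R[i] V false conjC hsum_inner hsum_hermitian.

Let hsum_dot (x : V) : x != 0 -> 0 < hsum_inner x x.
Proof.
move=> x0; rewrite lt_def addr_ge0 ?dnorm_ge0// andbT.
apply: contraNneq x0 => /eqP; rewrite paddr_eq0 ?dnorm_ge0// !dnorm_eq0.
by case: x => x1 x2 /= /andP[/eqP-> /eqP->].
Qed.

HB.instance Definition _ := isDotProduct.Build R[i] V hsum_inner hsum_dot.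

Definition hsum_norm (x : V) : R[i] := sqrtC (hsum_inner x x).

Let hsum_normD x y : hsum_norm (x + y) <= hsum_norm x + hsum_norm y.
Proof. exact: dot_triangle. Qed.

Let hsum_normZ (l : R[i]) x : hsum_norm (l *: x) = `|l| * hsum_norm x.
Proof.
rewrite /hsum_norm dnormZ sqrtCM ?nnegrE ?exprn_ge0 ?dnorm_ge0//.
by rewrite sqrCK.
Qed.

Let hsum_norm0 x : hsum_norm x = 0 -> x = 0.
Proof. by move=> /eqP; rewrite sqrt_dnorm_eq0 => /eqP. Qed.

HB.instance Definition _ :=
  Lmodule_isNormed.Build R[i] V hsum_normD hsum_normZ hsum_norm0.

Lemma sqr_norm_hsum (x : V) : `|x| ^+ 2 = `|x.1| ^+ 2 + `|x.2| ^+ 2.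
Proof. by rewrite [LHS]sqrtCK !sqr_norm_inner. Qed.

Lemma hsum_norm1_le (x : V) : `|x.1| <= `|x|.
Proof. by rewrite -ler_sqr ?nnegrE// sqr_norm_hsum lerDl exprn_ge0. Qed.

Lemma hsum_norm2_le (x : V) : `|x.2| <= `|x|.
Proof. by rewrite -ler_sqr ?nnegrE// sqr_norm_hsum lerDr exprn_ge0. Qed.

Lemma hsum_norm_le (x : V) : `|x| <= `|x.1| + `|x.2|.
Proof.
rewrite -ler_sqr ?nnegrE ?addr_ge0// sqr_norm_hsum sqrrD addrAC.
by rewrite lerDl mulrn_wge0 ?mulr_ge0.
Qed.

Let hsum_complete (F : set_system V) : ProperFilter F -> cauchy F -> cvg F.
Proof.
move=> FF /cauchyP Fc.
have F1 : cvg ((fun x : V => x.1) @ F).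
  apply/cauchy_cvgP/cauchy_exP => e e0; have [x xe] := Fc _ e0.
  exists x.1; suff: F [set y : V | ball x.1 e y.1] by [].
  apply: filterS xe => y; rewrite -!ball_normE /=.
  move=> xy; apply: le_lt_trans xy.
  exact: (hsum_norm1_le (x - y)).
have F2 : cvg ((fun x : V => x.2) @ F).
  apply/cauchy_cvgP/cauchy_exP => e e0; have [x xe] := Fc _ e0.
  exists x.2; suff: F [set y : V | ball x.2 e y.2] by [].
  apply: filterS xe => y; rewrite -!ball_normE /=.
  move=> xy; apply: le_lt_trans xy.
  exact: (hsum_norm2_le (x - y)).
apply/cvg_ex.
exists (lim ((fun x : V => x.1) @ F), lim ((fun x : V => x.2) @ F)).
apply/cvgrPdist_lt => e e0.
have e20 : 0 < e / 2 by rewrite divr_gt0.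
have /cvgrPdist_lt/(_ _ e20) := F1; have /cvgrPdist_lt/(_ _ e20) := F2.
apply: filterS2 => x x2 x1; apply: le_lt_trans (hsum_norm_le _) _.
by rewrite (splitr e) ltrD.
Qed.

HB.instance Definition _ := Uniform_isComplete.Build V hsum_complete.

Let hsum_sqr_norm (x : V) : `|x| ^+ 2 = hsum_inner x x.
Proof. exact: sqrtCK. Qed.

HB.instance Definition _ :=
  NormedModule_isHilbert.Build R V hsum_sqr_norm.

End HilbertSum.

Section BoundedOperators.
Variables (R : realType) (H : hilbertType R).

Definition bounded_op : {pred H -> H} := [pred f : H -> H |
  `[< linear f /\ exists M : R, forall x, `|f x| <= M%:C%C * `|x| >] ].

Record bop := Bop {bop_val :> H -> H; _ : bop_val \in bounded_op}.

HB.instance Definition _ := [isSub for bop_val].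
HB.instance Definition _ := [Choice of bop by <:].

Lemma bounded_opP f : reflect
  (linear f /\ exists M : R, forall x, `|f x| <= M%:C%C * `|x|) (f \in bounded_op).
Proof. exact: asboolP. Qed.

Let bounded_op_submod : submod_closed bounded_op.
Proof.
split=> [|a f g /bounded_opP[lf [M fM]] /bounded_opP[lg [N gN]]].
  apply/bounded_opP; split=> [a x y|]; first by rewrite scaler0 addr0.
  by exists 0 => x; rewrite normr0 mul0r.
apply/bounded_opP; split=> [b x y|].
  rewrite [LHS]/(a *: f _ + g _) lf lg scalerDr scalerDr !scalerA mulrC.
  by rewrite addrACA.
exists (complex.Re `|a| * M + N) => x; apply: le_trans (ler_normD _ _) _.
have aE : (complex.Re `|a|)%:C%C = `|a| by rewrite RRe_real ?normr_real.
have -> : (complex.Re `|a| * M + N)%:C%C = `|a| * M%:C%C + N%:C%C.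
  by rewrite -aE -rmorphM -rmorphD.
rewrite mulrDl lerD//.
by rewrite normrZ -mulrA ler_wpM2l.
Qed.

HB.instance Definition _ :=
  GRing.isSubmodClosed.Build R[i] (H -> H) bounded_op bounded_op_submod.
HB.instance Definition _ := [SubChoice_isSubLmodule of bop by <:].

Lemma bop_linear (S : bop) : linear S.
Proof. by case: S => f /= /bounded_opP[]. Qed.

HB.instance Definition _ (S : bop) :=
  GRing.isLinear.Build R[i] H H _ S (bop_linear S).

Lemma bop_bounded (S : bop) : exists M : R, forall x, `|S x| <= M%:C%C * `|x|.
Proof. by case: S => f /= /bounded_opP[]. Qed.

Lemma bopP (S S' : bop) : (forall x, S x = S' x) -> S = S'.
Proof. by move=> SS'; apply: val_inj; apply/funext. Qed.

End BoundedOperators.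

Notation "''B' ( H )" := (bop H) (at level 8, format "''B' ( H )") : type_scope.

(* The representing vector is the limit of a minimizing filter of
   J x = |x|^2 - 2 Re (phi x). *)
Section Riesz.
Variables (R : realType) (H : hilbertType R).
Variable phi : {scalar H}.
Variable M : R.
Hypothesis phi_bound : forall x, `|phi x| <= M%:C%C * `|x|.

Local Notation Re := (@complex.Re R).
Implicit Types x y z h : H.
Local Notation r x y := (Re (inner x y)).

Let ReD a b : Re (a + b) = Re a + Re b. Proof. by case: a b => ? ? []. Qed.
Let ReN a : Re (- a) = - Re a. Proof. by case: a. Qed.

Let ReC (a : R[i]) : Re (conjC a) = Re a. Proof. by case: a. Qed.

Let rC x y : r x y = r y x.
Proof. by rewrite [in LHS]hermC expr0 mul1r; exact: ReC. Qed.
Let rDl x y z : r (x + y) z = r x z + r y z.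
Proof. by rewrite linearDl ReD. Qed.
Let rNl x z : r (- x) z = - r x z.
Proof. by rewrite linearNl ReN. Qed.
Let rDr x y z : r z (x + y) = r z x + r z y.
Proof. by rewrite linearDr ReD. Qed.
Let rNr x z : r z (- x) = - r z x.
Proof. by rewrite linearNr ReN. Qed.

Let nrm x : R := Re `|x|.
Let nrmE x : `|x| = (nrm x)%:C%C.
Proof. by rewrite /nrm RRe_real// normr_real. Qed.
Let nrm_ge0 x : 0 <= nrm x.
Proof. by rewrite -ler0c -nrmE. Qed.
Let rxx x : r x x = nrm x ^+ 2.
Proof. by rewrite -sqr_norm_inner nrmE -rmorphXn. Qed.

Let J x : R := r x x - 2 * Re (phi x).

Let J_lb x : - M ^+ 2 <= J x.
Proof.
have : `|Re (phi x)| <= M * nrm x.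
  by rewrite -lecR rmorphM /= -nrmE; apply: le_trans (phi_bound x); exact: normc_ge_Re.
move=> /ler_normlW ?.
by rewrite /J rxx; have := sqr_ge0 (nrm x - M); nra.
Qed.

Let m := inf (range J).
Let hasinf : has_inf (range J).
Proof.
split; first by exists (J 0), 0.
by exists (- M ^+ 2) => _ [x _ <-]; exact: J_lb.
Qed.

Let m_le x : m <= J x.
Proof. by apply: ge_inf; [exact: hasinf.2|exists x]. Qed.

Let half x : exists y, x = y + y.
Proof.
exists ((1 / 2 : R[i]) *: x).
by rewrite -scalerDl -splitr scale1r.
Qed.

Let J_dist x y : nrm (x - y) ^+ 2 <= 2 * (J x + J y - 2 * m).
Proof.
have [z xyz] := half (x + y).
have := m_le z; rewrite -rxx /J.
have : r (x + y) (x + y) = 4 * r z z by rewrite xyz !rDl !rDr; lra.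
have : Re (phi x) + Re (phi y) = 2 * Re (phi z).
  by rewrite -ReD -raddfD xyz raddfD /= ReD; lra.
rewrite !rDl !rDr !rNl !rNr (rC y x); lra.
Qed.

Let F : set_system H := filter_from [set d : R | 0 < d] (fun d => [set x | J x < m + d]).

Let F_proper : ProperFilter F.
Proof.
apply: filter_from_proper; last first.
  by move=> d /= d0; have [_ [x _ <-] xd] := inf_adherent d0 hasinf; exists x.
apply: filter_from_filter; first by exists 1 => /=.
move=> d d' /= d0 d'0; exists (Num.min d d'); first by rewrite /= lt_min d0.
by move=> x /=; rewrite -ltrBlDl lt_min => /andP[]; rewrite !ltrBlDl.
Qed.

Let F_cvg : cvg F.
Proof.
have FF := F_proper.
apply/cauchy_cvgP/cauchy_exP => e e0.
have /complex_realP[k ek] := gtr0_real e0.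
have k0 : 0 < k by move: e0; rewrite ek ltcR.
have d0 : 0 < k ^+ 2 / 4 by rewrite divr_gt0 ?exprn_gt0.
have [_ [x _ <-] xd] := inf_adherent d0 hasinf; exists x.
exists (k ^+ 2 / 4) => //= y yd; rewrite -ball_normE /= ek nrmE ltcR.
rewrite -ltr_sqr ?nnegrE ?(ltW k0)//; have := J_dist x y.
have {}xd : J x < m + k ^+ 2 / 4 := xd.
have {}yd : J y < m + k ^+ 2 / 4 := yd.
by move: xd yd; lra.
Qed.

Let c x h : R[i] := inner h x - phi h.
Let nsq (a : R[i]) : R := Re a ^+ 2 + complex.Im a ^+ 2.

Let c_bound d x h : J x < m + d -> nsq (c x h) <= d * (1 + nrm h ^+ 2).
Proof.
move=> xd; pose s := (1 + nrm h ^+ 2)^-1.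
have h0 : 0 < 1 + nrm h ^+ 2 by rewrite ltr_pwDl// sqr_ge0.
have s0 : 0 < s by rewrite invr_gt0.
have sh : s * (1 + nrm h ^+ 2) = 1 by rewrite mulVf// gt_eqF.
pose t : R[i] := - (s%:C%C * conjc (c x h)).
have := m_le (x + t *: h); rewrite /J !rDl !rDr (rC x) raddfD /= ReD.
rewrite !linearZl_LR linearZr_LR /=.
have -> : phi (t *: h) = t * phi h by rewrite linearZ.
have -> : Re (t * inner h x) = Re (t * phi h) - s * nsq (c x h).
  have -> : inner h x = c x h + phi h by rewrite subrK.
  rewrite mulrDr ReD /t /nsq; case: (c x h) => a b; simpc.
  by rewrite /=; ring.
have -> : Re (t * (t^* * inner h h)) = s ^+ 2 * nsq (c x h) * nrm h ^+ 2.
  have -> : inner h h = (nrm h ^+ 2)%:C%C.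
    by rewrite -sqr_norm_inner nrmE rmorphXn.
  have -> : t^* = - (s%:C%C * c x h).
    have -> (a : R[i]) : conjC a = conjc a by [].
    by rewrite /t rmorphN rmorphM /= conjcK oppr0.
  rewrite /t /nsq; case: (c x h) => a b; simpc => /=; ring.
have : 0 <= nsq (c x h) by rewrite addr_ge0 ?sqr_ge0.
move: xd h0 sh; rewrite /J; set N := nsq _; set w := nrm h ^+ 2.
move=> xd h0 sh N0 mle.
have sN : s * N <= d.
  have sw : s * w = 1 - s by rewrite -sh; ring.
  have : s ^+ 2 * N * w = s * N * (1 - s) by rewrite -sw; ring.
  have := mulr_ge0 (mulr_ge0 (ltW s0) (ltW s0)) N0; nra.
have -> : N = s * N * (1 + w) by rewrite mulrAC sh mul1r.
by rewrite ler_wpM2r// ltW.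
Qed.

Lemma Riesz_representation : exists z, forall x, phi x = inner x z.
Proof.
have FF := F_proper.
exists (lim F) => h; apply/esym/eqP; rewrite -subr_eq0 -/(c _ h).
suff K0 : nsq (c (lim F) h) <= 0.
  move: K0; rewrite /nsq; case: (c _ h) => a b /= ab.
  have [a0 b0] : a ^+ 2 = 0 /\ b ^+ 2 = 0.
    by move: (sqr_ge0 a) (sqr_ge0 b) ab; lra.
  by rewrite eq_complex /= -!(sqrf_eq0 a) -(sqrf_eq0 b) a0 b0 eqxx.
have h0 : 0 < 1 + nrm h ^+ 2 by rewrite ltr_pwDl// sqr_ge0.
apply/ler_addgt0Pl => e e0; rewrite addr0.
pose d := e / (4 * (1 + nrm h ^+ 2)).
have d0 : 0 < d by rewrite divr_gt0// mulr_gt0.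
have sd0 : 0 < (Num.sqrt d)%:C%C by rewrite ltcR sqrtr_gt0.
have Fl : F --> lim F := F_cvg.
have F1 : F (ball (lim F) (Num.sqrt d)%:C%C) by exact/Fl/nbhsx_ballx.
have F2 : F [set x | J x < m + d] by exists d.
have [x [xl xd]] := filter_ex (filterI F1 F2).
move: xl; rewrite -ball_normE /= => xl.
have c2 := c_bound h xd.
have cE : c (lim F) h = inner h (lim F - x) + c x h.
  by rewrite /c linearBr /= addrA subrK.
have i1 : nsq (inner h (lim F - x)) <= nrm h ^+ 2 * d.
  rewrite -lecR /nsq add_Re2_Im2.
  apply: (@le_trans _ _ ((`|h| * `|lim F - x|) ^+ 2)).
    by rewrite ler_sqr ?nnegrE ?mulr_ge0// inner_CauchySchwarz.
  rewrite exprMn rmorphM rmorphXn /= -nrmE ler_wpM2l ?exprn_ge0//.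
  rewrite -[d]sqr_sqrtr ?(ltW d0)// rmorphXn ler_sqr ?nnegrE ?(ltW sd0)//.
  exact: ltW.
have nsqD a b : nsq (a + b) <= 2 * (nsq a + nsq b).
  case: a b => [a1 a2] [b1 b2]; rewrite /nsq /=.
  by have := sqr_ge0 (a1 - b1); have := sqr_ge0 (a2 - b2); nra.
rewrite cE; apply: le_trans (nsqD _ _) _.
have dE : d * (1 + nrm h ^+ 2) = e / 4.
  by rewrite /d; field; rewrite gt_eqF.
by move: i1 c2 dE d0; nra.
Qed.

End Riesz.
Section Adjoint.
Variables (R : realType) (H : hilbertType R).
Implicit Types (S A B C D : 'B(H)) (x y : H).

Lemma bop_bounded_ge0 S :
  exists2 M : R, 0 <= M & forall x, `|S x| <= M%:C%C * `|x|.
Proof.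
have [M SM] := bop_bounded S; exists (Num.max M 0).
  by rewrite le_max lexx orbT.
move=> x; apply: le_trans (SM x) _.
by rewrite ler_wpM2r// lecR le_max lexx.
Qed.

Lemma adj_exists S :
  exists S' : 'B(H), forall x y, inner (S x) y = inner x (S' y).
Proof.
have [M M0 SM] := bop_bounded_ge0 S.
have /choice[f fP] y : exists z, forall x, inner (S x) y = inner x z.
  pose phi x : R[i] := inner (S x) y.
  have phi_lin : scalar phi by move=> a u v; rewrite /phi bop_linear linearPl.
  pose phiL := GRing.isLinear.Build _ _ _ _ phi phi_lin.
  pose Phi : {scalar H} := HB.pack phi phiL.
  apply: (@Riesz_representation R H Phi (M * complex.Re `|y|)) => x /=.
  apply: le_trans (inner_CauchySchwarz _ _) _.
  rewrite rmorphM /= RRe_real ?normr_real// mulrAC.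
  by rewrite ler_wpM2r.
have f_lin : linear f.
  move=> a u v; apply: inner_ext => x.
  by rewrite -fP !linearPr /= !fP.
have f_bop : f \in @bounded_op R H.
  apply/bounded_opP; split=> //; exists M => y.
  have [fy0|fy0] := eqVneq `|f y| 0.
    by rewrite fy0 mulr_ge0// ler0c.
  have fy_gt0 : 0 < `|f y| by rewrite lt_def fy0 normr_ge0.
  rewrite -(ler_pM2l fy_gt0) -expr2 sqr_norm_inner -fP.
  rewrite -[leLHS]ger0_norm ?fP ?dnorm_ge0// -fP.
  apply: le_trans (inner_CauchySchwarz _ _) _.
  by rewrite mulrCA mulrA ler_wpM2r// SM.
by exists (Bop f_bop).
Qed.

Definition adj S : 'B(H) := sval (cid (adj_exists S)).

Lemma adjP S x y : inner (S x) y = inner x (adj S y).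
Proof. by rewrite /adj; case: cid => S' /= ->. Qed.

Definition re_op S : 'B(H) := 2^-1 *: (S + adj S).
Definition im_op S : 'B(H) := (2 * 'i)^-1 *: (S - adj S).

Lemma cartesian_decomposition S : S = re_op S + 'i *: im_op S.
Proof.
rewrite /re_op /im_op scalerA invfM mulrCA divff ?neq0Ci// mulr1.
rewrite -scalerDr addrACA subrr addr0 scalerDr -scalerDl.
have -> : 2^-1 + 2^-1 = 1 :> R[i] by rewrite [RHS]splitr !div1r.
by rewrite scale1r.
Qed.

Definition opnorm S : R :=
  sup [set complex.Re `|S x| | x in [set x : H | `|x| <= 1]].

(* In the trivial space there is no unit vector and this is sup set0 = 0. *)
Definition numradius S : R :=
  sup [set complex.Re `|inner (S x) x| | x in [set x : H | `|x| = 1]].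

(* The matrix [A B; C D] acting on column vectors. *)
Definition block_fun A B C D (x : hsum H H) : hsum H H :=
  (A x.1 + B x.2, C x.1 + D x.2).

Lemma block_fun_bounded A B C D : block_fun A B C D \in @bounded_op R (hsum H H).
Proof.
apply/bounded_opP; split=> [a [x1 x2] [y1 y2]|].
  rewrite /block_fun /= !linearP.
  by congr (_, _) => /=; rewrite addrACA -scalerDr.
have [MA A0 AM] := bop_bounded_ge0 A; have [MB B0 BM] := bop_bounded_ge0 B.
have [MC C0 CM] := bop_bounded_ge0 C; have [MD D0 DM] := bop_bounded_ge0 D.
exists (MA + MB + (MC + MD)) => x.
apply: le_trans (hsum_norm_le _) _.
rewrite !rmorphD /= !mulrDl.
have b (E : 'B(H)) (M : R) : 0 <= M -> (forall x : H, `|E x| <= M%:C%C * `|x|) ->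
    (`|E x.1| <= M%:C%C * `|x|) /\ (`|E x.2| <= M%:C%C * `|x|).
  move=> M0 EM; split; apply: le_trans (EM _) _; rewrite ler_wpM2l ?ler0c//.
    exact: hsum_norm1_le.
  exact: hsum_norm2_le.
have [A1 _] := b A MA A0 AM; have [_ B2] := b B MB B0 BM.
have [C1 _] := b C MC C0 CM; have [_ D2] := b D MD D0 DM.
apply: lerD; (apply: le_trans (ler_normD _ _) _; exact: lerD).
Qed.

Definition block_op A B C D : 'B(hsum H H) := Bop (block_fun_bounded A B C D).

End Adjoint.

(* alpha for the blocks of the real part, beta for those of the imaginary part. *)
Definition block_bound (R : realType) (H : hilbertType R)
    (A11 A12 A22 : 'B(H)) : R :=
  Num.max (opnorm A11) (Num.max (opnorm A22)
    (Num.max (opnorm (A12 + adj A12) / 2) (opnorm (A12 - adj A12) / 2))).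

(* Main.v *)
Require Import Defs.
From HB Require Import structures.
From mathcomp Require Import all_boot all_order all_algebra.
From mathcomp Require Import reals.
From mathcomp Require Import complex ring.
From mathcomp Require Import boolp classical_sets.
From mathcomp Require Import topology normedtype.

(** Write w for the numerical radius of T, so that |<T v, v>| <= w |v|^2 for
    every v ([numradius_quad_bound]). The real and imaginary parts of T have
    quadratic forms Re <T v, v> and Im <T v, v>, hence they obey the same bound,
    and they are symmetric. It is therefore enough to bound by w each entry of
    [block_bound] for a symmetric block operator S = [A11 A12; A12' A22], A12'
    being the adjoint of A12, whose quadratic form is at most w
    ([block_bound_le]).

    Everything rests on one polarization estimate ([polarized_quad_bound]):
    subtracting the values of the form at u + v and u - v and using the
    parallelogram law gives |<S u, v> + <S v, u>| <= w (|u|^2 + |v|^2). It is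
    used in two ways.
    - With v = S u, up to scaling, it shows that a symmetric operator has norm
      at most the bound of its quadratic form ([symmetric_opnorm_le]). Restricting S to vectors
      (x, 0) and (0, x) then bounds A11 and A22.
    - On H (+) H, the vectors (x, 0) and (0, x) give
      |<(A12 + A12') x, x>| <= 2 w |x|^2, and (x, 0) and (0, i x) give
      |<i (A12 - A12') x, x>| <= 2 w |x|^2. Both A12 + A12' and i (A12 - A12')
      are symmetric, so their norms are at most 2 w.

    For sharpness, T is the identity of C (+) C: its numerical radius is 1 and
    the norm of A11 = 1 already attains it. The complex line is given its
    Hilbert space structure first, completeness being checked on real and
    imaginary parts separately. *)

Set Implicit Arguments.
Unset Strict Implicit.
Unset Printing Implicit Defensive.

Import Order.TTheory GRing.Theory Num.Theory Num.Def.
Import numFieldNormedType.Exports.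

Local Open Scope classical_set_scope.
Local Open Scope ring_scope.

(** * Quadratic forms and the numerical radius *)

Section NumericalRadius.
Variables (R : realType) (H : hilbertType R).
Implicit Types (S K T : 'B(H)) (x y u v : H) (w : R).

Definition quad_bound w S :=
  forall x, `|inner (S x) x| <= w%:C%C * `|x| ^+ 2.

Definition symmetric S := forall x y, inner (S x) y = inner x (S y).

Lemma Re_norm_le (K : normedModType R[i]) (x : K) w :
  `|x| <= w%:C%C -> complex.Re `|x| <= w.
Proof. by rewrite -lecR RRe_real ?normr_real. Qed.

Lemma numradius_has_ub T :
  has_ubound [set complex.Re `|inner (T x) x| | x in [set x : H | `|x| = 1]].
Proof.
have [M TM] := bop_bounded T.
exists M => _ [x /= x1 <-].
apply: (@Re_norm_le R[i]^o); apply: le_trans (inner_CauchySchwarz _ _) _.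
by rewrite x1 mulr1; have := TM x; rewrite x1 mulr1.
Qed.

Lemma numradius_ge0 T : 0 <= numradius T.
Proof.
rewrite /numradius; set A := [set _ | _ in _].
have [A0|/set0P[r Ar]] := eqVneq A set0; first by rewrite A0 sup0.
apply: (@le_trans _ _ r); last by apply: ub_le_sup => //; exact: numradius_has_ub.
by case: Ar => x _ <-; rewrite -ler0c RRe_real ?normr_real.
Qed.

(** Homogeneity of degree two extends the bound from the unit sphere to all
    vectors; since x = 0 is treated apart, this includes the trivial space. *)
Lemma numradius_quad_bound T : quad_bound (numradius T) T.
Proof.
move=> x; have [->|x0] := eqVneq x 0.
  by rewrite linear0r !normr0 expr0n mulr0.
have nx0 : `|x| != 0 by rewrite normr_eq0.
pose y := `|x|^-1 *: x.
have y1 : `|y| = 1 by rewrite normrZ normfV normr_id mulVf.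
have xE : x = `|x| *: y by rewrite scalerA divff// scale1r.
have -> : inner (T x) x = `|x| ^+ 2 * inner (T y) y.
  transitivity (inner (`|x| *: T y) (`|x| *: y)); first by rewrite -linearZ -xE.
  by rewrite linearZl_LR linearZr_LR /= mulrA -normCK normr_id.
rewrite normrM normrX normr_id.
rewrite mulrC ler_wpM2r ?exprn_ge0//.
rewrite -[`|inner _ _|]RRe_real ?normr_real// lecR.
by apply: ub_le_sup; [exact: numradius_has_ub|exists y].
Qed.

Lemma adjPr S x y : inner (adj S x) y = inner x (S y).
Proof. by rewrite hermC [RHS]hermC /= adjP. Qed.

(** Real and imaginary parts of a complex number are both c * (a + b) with b
    equal to the conjugate of a up to sign, and c = 1/2 or 1/(2i). *)
Lemma norm_half_sum_le (c a b : R[i]) :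
  `|c| = 2^-1 -> `|b| = `|a| -> `|c * (a + b)| <= `|a|.
Proof.
move=> c2 ba; rewrite normrM c2 ler_pdivrMl ?ltr0n//.
by apply: le_trans (ler_normD _ _) _; rewrite ba mulr_natl mulr2n.
Qed.

Lemma re_op_symmetric T : symmetric (re_op T).
Proof.
move=> x y; rewrite /re_op.
rewrite [(_ *: _ : 'B(H)) x]/(2^-1 *: (T x + adj T x)).
rewrite [(_ *: _ : 'B(H)) y]/(2^-1 *: (T y + adj T y)).
rewrite linearZl_LR linearZr_LR /= linearDl linearDr /= adjP adjPr.
by rewrite fmorphV rmorph_nat addrC.
Qed.

Lemma im_op_symmetric T : symmetric (im_op T).
Proof.
move=> x y; rewrite /im_op.
rewrite [(_ *: _ : 'B(H)) x]/((2 * 'i)^-1 *: (T x - adj T x)).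
rewrite [(_ *: _ : 'B(H)) y]/((2 * 'i)^-1 *: (T y - adj T y)).
rewrite linearZl_LR linearZr_LR /= linearBl linearBr /= adjP adjPr.
by rewrite fmorphV rmorphM rmorph_nat /= conjCi mulrN invrN mulNr -mulrN opprB.
Qed.

Lemma re_op_quad_bound w T : quad_bound w T -> quad_bound w (re_op T).
Proof.
move=> Tw x; apply: le_trans (Tw x); rewrite /re_op.
rewrite [(_ *: _ : 'B(H)) x]/(2^-1 *: (T x + adj T x)).
rewrite linearZl_LR /= linearDl /= adjPr; apply: norm_half_sum_le.
  by rewrite normfV normr_nat.
by rewrite hermC expr0 mul1r norm_conjC.
Qed.

Lemma im_op_quad_bound w T : quad_bound w T -> quad_bound w (im_op T).
Proof.
move=> Tw x; apply: le_trans (Tw x); rewrite /im_op.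
rewrite [(_ *: _ : 'B(H)) x]/((2 * 'i)^-1 *: (T x - adj T x)).
rewrite linearZl_LR /= linearBl /= adjPr; apply: norm_half_sum_le.
  by rewrite normfV normrM normr_nat normCi mulr1.
by rewrite normrN hermC expr0 mul1r norm_conjC.
Qed.

(** Polarization: the values of the form at u + v and u - v differ by twice the
    sum on the left, while the parallelogram law adds up their two bounds. No
    symmetry is involved, so the lemma also serves for the off-diagonal blocks,
    with u and v in different summands. *)
Lemma polarized_quad_bound w S u v : quad_bound w S ->
  `|inner (S u) v + inner (S v) u| <= w%:C%C * (`|u| ^+ 2 + `|v| ^+ 2).
Proof.
move=> Sw.
have pol : inner (S (u + v)) (u + v) - inner (S (u - v)) (u - v) =
    2 * (inner (S u) v + inner (S v) u).
  have SD : S (u + v) = S u + S v by rewrite linearD.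
  have SB : S (u - v) = S u - S v by rewrite linearB.
  by rewrite SD SB !linearDl !linearDr /= !linearNl !linearNr /=; ring.
have par : `|u + v| ^+ 2 + `|u - v| ^+ 2 = 2 * (`|u| ^+ 2 + `|v| ^+ 2).
  by rewrite !sqr_norm_inner !linearDl !linearDr /= !linearNl !linearNr /=; ring.
rewrite -(ler_pM2l (ltr0n R[i] 2)) mulrCA -par mulrDr.
rewrite -[X in X * `|_ + _| <= _]normr_nat -normrM -pol.
by apply: le_trans (ler_normB _ _) _; rewrite lerD.
Qed.

Lemma opnorm_le w S :
  (forall x, `|S x| <= w%:C%C * `|x|) -> 0 <= w -> opnorm S <= w.
Proof.
move=> Sw w0; apply: ge_sup.
  by exists (complex.Re `|S 0|), 0; rewrite //= normr0.
move=> _ [x /= x1 <-]; apply: Re_norm_le; apply: le_trans (Sw x) _.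
by rewrite -[leRHS]mulr1 ler_wpM2l// ler0c.
Qed.

(** By symmetry, the polarized form at x and K x is twice |K x|^2. Scaling x by
    w makes the resulting inequality
    2 w |K x|^2 <= w (w^2 |x|^2 + |K x|^2), that is |K x| <= w |x|. *)
Lemma symmetric_opnorm_le w K : 0 <= w -> symmetric K -> quad_bound w K ->
  opnorm K <= w.
Proof.
move=> w0 Ksym Kw; apply: opnorm_le => // x.
have w0C : 0 <= w%:C%C :> R[i] by rewrite ler0c.
rewrite -ler_sqr ?nnegrE ?mulr_ge0// exprMn.
(* The scaling loses all information when w = 0; there x itself is used. *)
have [wE|wn0] := eqVneq w 0.
  have := polarized_quad_bound x (K x) Kw.
  rewrite wE !mul0r normr_le0 (Ksym (K x)) -sqr_norm_inner -mulr2n mulrn_eq0 /=.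
  by move=> /eqP->; rewrite expr0n mul0r.
have wp : 0 < w%:C%C :> R[i] by rewrite ltcR lt_def wn0.
have := polarized_quad_bound (w%:C%C *: x) (K x) Kw.
have Kwx : K (w%:C%C *: x) = w%:C%C *: K x by rewrite linearZ.
rewrite (Ksym (K x)) Kwx linearZl_LR linearZr_LR /= -sqr_norm_inner.
rewrite (conj_Creal (ger0_real w0C)) -mulrDr normrM (ger0_norm w0C).
rewrite ler_pM2l// normrZ (ger0_norm w0C) ger0_norm ?addr_ge0 ?exprn_ge0//.
by rewrite lerD2r exprMn.
Qed.

End NumericalRadius.

(** * Bounds on the blocks *)

Section BlockBound.
Variables (R : realType) (H : hilbertType R).
Implicit Types (A B C D : 'B(H)) (x y : H) (w : R).

Lemma inner_hsum (u v : hsum H H) : inner u v = inner u.1 v.1 + inner u.2 v.2.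
Proof. by []. Qed.

Lemma symmetricP A : (adj A = A) <-> symmetric A.
Proof.
split=> [AA x y|As]; first by rewrite adjP AA.
by apply: bopP => y; apply: inner_ext => x; rewrite -adjP As.
Qed.

(** Compression to either summand bounds the diagonal blocks. The off-diagonal
    one is reached by polarizing between the two summands; multiplying one of
    the vectors by i exchanges A12 + adj A12 for i (A12 - adj A12). *)
Lemma block_bound_le w A11 A12 A22 : 0 <= w ->
  symmetric (block_op A11 A12 (adj A12) A22) ->
  quad_bound w (block_op A11 A12 (adj A12) A22) ->
  block_bound A11 A12 A22 <= w.
Proof.
set S := block_op _ _ _ _ => w0 Ss Sw.
pose inl x : hsum H H := (x, 0); pose inr x : hsum H H := (0, x).
have Sl x : S (inl x) = (A11 x, adj A12 x).
  by rewrite /S /= /block_fun /= !linear0 !addr0.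
have Sr x : S (inr x) = (A12 x, A22 x).
  by rewrite /S /= /block_fun /= !linear0 !add0r.
have nl x : `|inl x| ^+ 2 = `|x| ^+ 2.
  by rewrite sqr_norm_hsum normr0 expr0n addr0.
have nr x : `|inr x| ^+ 2 = `|x| ^+ 2.
  by rewrite sqr_norm_hsum normr0 expr0n add0r.
have A11s : symmetric A11.
  move=> x y; have := Ss (inl x) (inl y).
  by rewrite !Sl !inner_hsum /= linear0r linear0l !addr0.
have A22s : symmetric A22.
  move=> x y; have := Ss (inr x) (inr y).
  by rewrite !Sr !inner_hsum /= linear0r linear0l !add0r.
have A11w : quad_bound w A11.
  by move=> x; have := Sw (inl x); rewrite Sl nl inner_hsum /= linear0r addr0.
have A22w : quad_bound w A22.
  by move=> x; have := Sw (inr x); rewrite Sr nr inner_hsum /= linear0r add0r.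
have w2 : 0 <= w * 2 by rewrite mulr_ge0.
rewrite /block_bound !ge_max !symmetric_opnorm_le //=.
rewrite !ler_pdivrMr ?ltr0n//; apply/andP; split.
  apply: symmetric_opnorm_le => // [x y|x].
    rewrite [(_ + _ : 'B(H)) x]/(A12 x + adj A12 x).
    rewrite [(_ + _ : 'B(H)) y]/(A12 y + adj A12 y).
    by rewrite linearDl linearDr /= adjP adjPr addrC.
  have := polarized_quad_bound (inr x) (inl x) Sw.
  rewrite Sl Sr nl nr !inner_hsum /= !linear0r addr0 add0r -linearDl /=.
  by rewrite rmorphM rmorph_nat -mulrA mulr_natl.
(* A12 - adj A12 is skew; the factor i makes it symmetric at equal norm. *)
have -> : opnorm (A12 - adj A12) = opnorm ('i *: (A12 - adj A12)).
  rewrite /opnorm; congr (sup (image _ _)); apply/funext => x.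
  by rewrite [(_ *: _ : 'B(H)) x]/('i *: (A12 - adj A12) x) normrZ normCi mul1r.
have Ex x : ('i *: (A12 - adj A12)) x = 'i *: (A12 x - adj A12 x) by [].
apply: symmetric_opnorm_le => // [x y|x].
  rewrite !Ex linearZl_LR linearZr_LR linearBl linearBr /= adjP adjPr.
  by rewrite conjCi mulNr -mulrN opprB.
rewrite Ex; have := polarized_quad_bound (inr ('i *: x)) (inl x) Sw.
rewrite Sl Sr nl nr !inner_hsum /= !linear0r addr0 add0r.
have -> : A12 ('i *: x) = 'i *: A12 x by rewrite linearZ.
rewrite linearZr_LR normrZ normCi mul1r /= conjCi.
rewrite (linearZl_LR _ _ _ (A12 x)) (linearZl_LR _ _ _ (_ - _)) linearBl /=.
by rewrite mulrBr mulNr rmorphM rmorph_nat -mulrA mulr_natl.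
Qed.

Lemma cartesian_block_bound_le_numradius (T : 'B(hsum H H))
    A11 A12 A22 B11 B12 B22 :
  re_op T = block_op A11 A12 (adj A12) A22 ->
  im_op T = block_op B11 B12 (adj B12) B22 ->
  Num.max (block_bound A11 A12 A22) (block_bound B11 B12 B22) <= numradius T.
Proof.
move=> reT imT; rewrite ge_max; apply/andP.
have Tw := numradius_quad_bound T.
split; apply: block_bound_le (numradius_ge0 T) _ _; rewrite -?reT -?imT.
- exact: re_op_symmetric.
- exact: re_op_quad_bound.
- exact: im_op_symmetric.
- exact: im_op_quad_bound.
Qed.

End BlockBound.

(** * The complex line as a Hilbert space *)

(** A fresh name for R[i] as a module over itself, so that the instances below
    do not attach to R[i] everywhere. *)
Definition cline (R : realType) : Type := R[i]^o.

Section ComplexLine.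
Variable R : realType.
Local Notation V := (cline R).

HB.instance Definition _ := NormedModule.copy V R[i]^o.

Definition cline_inner (x y : V) : R[i] := (x : R[i]) * conjC (y : R[i]).

Let cline_bilinear : bilinear_for *%R (conjC \; *%R) cline_inner.
Proof.
split=> u a x y /=; rewrite /cline_inner /=.
  by rewrite mulrDl -mulrA.
by rewrite rmorphD rmorphM /= mulrDr mulrCA.
Qed.

HB.instance Definition _ :=
  bilinear_isBilinear.Build R[i] V V R[i] *%R (conjC \; *%R)
    cline_inner cline_bilinear.

Let cline_hermitian x y :
  cline_inner x y = (-1) ^+ false * conjC (cline_inner y x).
Proof. by rewrite /cline_inner expr0 mul1r rmorphM /= conjCK mulrC. Qed.

HB.instance Definition _ :=
  isHermitianSesquilinear.Build R[i] V false conjC cline_inner cline_hermitian.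

Let cline_dot (x : V) : x != 0 -> 0 < cline_inner x x.
Proof. by move=> x0; rewrite /cline_inner -normCK exprn_gt0// normr_gt0. Qed.

HB.instance Definition _ := isDotProduct.Build R[i] V cline_inner cline_dot.

Let norm_imaginary : `|'i%C| = 1 :> R[i].
Proof. by rewrite normc_def /= expr0n expr1n add0r sqrtr1. Qed.

Let norm_complex_le (z : R[i]) :
  `|z| <= (`|complex.Re z| + `|complex.Im z|)%:C%C.
Proof.
have normR (a : R) : `|a%:C%C| = (`|a|)%:C%C :> R[i].
  by rewrite normc_def /= expr0n addr0 sqrtr_sqr.
rewrite rmorphD /= -!normR [in leLHS](complexE z).
by apply: le_trans (ler_normD _ _) _; rewrite normrM norm_imaginary mul1r.
Qed.

Let normc_ge_Im (z : R[i]) : (`|complex.Im z|)%:C%C <= `|z|.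
Proof.
rewrite -normrN -ReiNIm; apply: le_trans (normc_ge_Re _) _.
by rewrite normrM norm_imaginary mulr1.
Qed.

(** Re and Im do not increase the norm, so they carry a Cauchy filter to Cauchy
    filters of R; the two limits assemble into a limit in the complex line. *)
Let cline_complete (F : set_system V) : ProperFilter F -> cauchy F -> cvg F.
Proof.
move=> FF /cauchyP Fc.
have proj_cvg (p : R[i] -> R) : {morph p : a b / a - b} ->
    (forall z, (`|p z|)%:C%C <= `|z|) -> cvg ((p : V -> R) @ F).
  move=> pB ple; apply/cauchy_cvgP/cauchy_exP => e e0.
  have eC0 : 0 < e%:C%C by rewrite ltcR.
  have [x xe] := Fc _ eC0.
  exists (p x); suff: F [set y : V | ball (p x) e (p y)] by [].
  apply: filterS xe => y; rewrite -!ball_normE /= => xy.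
  by rewrite -pB -ltcR; apply: le_lt_trans xy.
have F1 : cvg ((@complex.Re R : V -> R) @ F).
  by apply: proj_cvg => [[a b] [c d] //|z]; exact: normc_ge_Re.
have F2 : cvg ((@complex.Im R : V -> R) @ F).
  by apply: proj_cvg => [[a b] [c d]|]; last exact: normc_ge_Im.
apply/cvg_ex.
exists ((lim ((@complex.Re R : V -> R) @ F) +i*
         lim ((@complex.Im R : V -> R) @ F))%C : V).
apply/cvgrPdist_lt => e e0.
have /complex_realP[k ek] := gtr0_real e0.
have k0 : 0 < k / 2 by rewrite divr_gt0//; move: e0; rewrite ek ltcR.
have /cvgrPdist_lt/(_ _ k0) := F1; have /cvgrPdist_lt/(_ _ k0) := F2.
apply: filterS2 => -[a b] /= x2 x1; apply: le_lt_trans (norm_complex_le _) _.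
by rewrite ek ltcR (splitr k) ltrD.
Qed.

HB.instance Definition _ := Uniform_isComplete.Build V cline_complete.

Let cline_sqr_norm (x : V) : `|x| ^+ 2 = cline_inner x x.
Proof. exact: normCK. Qed.

HB.instance Definition _ :=
  NormedModule_isHilbert.Build R V cline_sqr_norm.

End ComplexLine.

(** * The identity operator *)

Section Identity.
Variable R : realType.

Lemma id_bounded (H : hilbertType R) : @idfun H \in @bounded_op R H.
Proof.
by apply/bounded_opP; split=> //; exists 1 => x; rewrite mul1r.
Qed.

Definition id_op (H : hilbertType R) : 'B(H) := Bop (id_bounded H).

Lemma adj_id (H : hilbertType R) : adj (id_op H) = id_op H.
Proof. exact/symmetricP. Qed.

Lemma adj0 (H : hilbertType R) : adj (0 : 'B(H)) = 0.
Proof. by apply/symmetricP => x y; rewrite linear0l linear0r. Qed.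

Lemma block_op_id (H : hilbertType R) :
  block_op (id_op H) 0 0 (id_op H) = id_op (hsum H H).
Proof.
by apply: bopP => -[x y]; congr (_, _); rewrite /= ?addr0 ?add0r.
Qed.

Lemma block_op0 (H : hilbertType R) :
  block_op 0 0 0 0 = 0 :> 'B(hsum H H).
Proof. by apply: bopP => -[x y]; congr (_, _); rewrite /= ?addr0 ?add0r. Qed.

Lemma im_op_id (H : hilbertType R) : im_op (id_op H) = 0.
Proof. by rewrite /im_op adj_id subrr scaler0. Qed.

Lemma re_op_id (H : hilbertType R) : re_op (id_op H) = id_op H.
Proof.
by rewrite [RHS]cartesian_decomposition im_op_id scaler0 addr0.
Qed.

Lemma numradius_id (H : hilbertType R) (x : H) :
  `|x| = 1 -> numradius (id_op H) = 1.
Proof.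
move=> x1.
have form1 (y : H) : `|y| = 1 -> complex.Re `|inner (id_op H y) y| = 1.
  by move=> y1; rewrite -[id_op H y]/y -sqr_norm_inner y1 expr1n normr1.
apply/eqP; rewrite eq_le; apply/andP; split.
  apply: ge_sup => [|_ [y y1 <-]]; last by rewrite form1.
  by exists 1, x => //; exact: form1.
apply: ub_le_sup; first exact: numradius_has_ub.
by exists x => //; exact: form1.
Qed.

Lemma opnorm_id (H : hilbertType R) (x : H) :
  `|x| = 1 -> opnorm (id_op H) = 1.
Proof.
move=> x1; apply/eqP; rewrite eq_le opnorm_le//=; last first.
  by move=> y; rewrite mul1r.
apply: ub_le_sup; first by exists 1 => _ [y /= y1 <-]; exact: Re_norm_le.
by exists x; rewrite /= x1.
Qed.

End Identity.

Theorem theorem2p4 (R : realType) :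
  (forall (H : hilbertType R) (T : 'B(hsum H H))
          (A11 A12 A22 B11 B12 B22 : 'B(H)),
     re_op T = block_op A11 A12 (adj A12) A22 ->
     im_op T = block_op B11 B12 (adj B12) B22 ->
     Num.max (block_bound A11 A12 A22) (block_bound B11 B12 B22)
       <= numradius T)
  /\
  (exists (H : hilbertType R) (T : 'B(hsum H H))
          (A11 A12 A22 B11 B12 B22 : 'B(H)),
     [/\ re_op T = block_op A11 A12 (adj A12) A22,
         im_op T = block_op B11 B12 (adj B12) B22,
         Num.max (block_bound A11 A12 A22) (block_bound B11 B12 B22)
           = numradius T
       & numradius T != 0]).
Proof.
split=> [H T *|]; first exact: cartesian_block_bound_le_numradius.
pose H : hilbertType R := cline R; pose e : H := (1 : R[i]).
have e1 : `|e| = 1 by exact: normr1.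
have ee1 : `|(e, 0) : hsum H H| = 1.
  by apply/eqP; rewrite -sqrp_eq1// sqr_norm_hsum e1 normr0 expr1n expr0n addr0.
have reT : re_op (id_op (hsum H H)) = block_op (id_op H) 0 (adj 0) (id_op H).
  by rewrite re_op_id adj0 block_op_id.
have imT : im_op (id_op (hsum H H)) = block_op 0 0 (adj 0) 0.
  by rewrite im_op_id adj0 block_op0.
exists H, (id_op (hsum H H)), (id_op H), 0, (id_op H), 0, 0, 0; split=> //.
  apply/eqP; rewrite eq_le cartesian_block_bound_le_numradius//=.
  by rewrite (numradius_id ee1) !le_max (opnorm_id e1) lexx.
by rewrite (numradius_id ee1) oner_eq0.
Qed.
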